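(* Let $n\ge 1$ and let $T\in \mathrm{T}_{n-1}$ be a binary tree. The map $w\mapsto I_T(w)$ is a bijection between the symmetric group $\mathfrak S_n$ and the set of lower sets of the poset $\mathcal R_T$. Define a partial order $\le_T$ on $\mathfrak S_n$ by $v\le_T w$ if and only if $I_T(v)\subset I_T(w)$. Then $(\mathfrak S_n,\le_T)$ is a distributive lattice.
   Context: Permutations $w\in\mathfrak S_n$ are written as words $w=w_1\cdots w_n$. The poset $\mathcal P_n$ is the set of pairs of integers $(i,j)$ with $1\le i<j\le n$, ordered by $(i_1,j_1)\le(i_2,j_2)$ iff $i_2\le i_1$ and $j_1\le j_2$. For $\sigma=\sigma_1\cdots\sigma_{n-1}\in\mathfrak S_{n-1}$ and $1\le k\le n-1$ let $$\mathcal R_{\sigma,k}=\{x\in\mathcal P_n:\ (k,k+1)\le x\ \text{and}\ (\sigma_\ell,\sigma_\ell+1)\not\le x\ \text{for all}\ \ell<\sigma^{-1}(k)\}.$$ These sets partition $\mathcal P_n$; each gets the order induced from $\mathcal P_n$, and $\mathcal R_\sigma$ is the disjoint union of the posets $\mathcal R_{\sigma,k}$ (elements of different parts are incomparable). $\mathrm T_{n-1}$ is the set of binary trees with internal nodes labelled $1,\dots,n-1$ in in-order (binary search trees). The binary search tree of $\sigma$ has root $\sigma_1$, and its left (resp. right) subtree is the binary search tree of the subword of $\sigma$ of values smaller (resp. greater) than $\sigma_1$. Every $T\in \mathrm T_{n-1}$ is the binary search tree of some $\sigma\in\mathfrak S_{n-1}$, and $\mathcal R_\sigma$ and the $\mathcal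 R_{\sigma,k}$ depend only on $T$; they are written $\mathcal R_T$ and $\mathcal R_{T,k}$. Let $(i_{T,k},j_{T,k})$ be the maximum of $\mathcal R_{T,k}$, so that $\mathcal R_{T,k}=\{(i,j): i_{T,k}\le i\le k,\ k+1\le j\le j_{T,k}\}$. For $w\in\mathfrak S_n$ let $w^{L,k}$ (resp. $w^{R,k}$) be the subword of $w$ consisting of the values in $[i_{T,k},k]$ (resp. in $[k+1,j_{T,k}]$). Then $I_T(w)\subset\mathcal R_T$ is the set such that, for all $1\le k\le n-1$, $i_{T,k}\le i\le k$, $k+1\le j\le j_{T,k}$: $(i,j)\in I_T(w)$ iff the value $w^{L,k}_{i-i_{T,k}+1}$ appears after the value $w^{R,k}_{j-k}$ in $w$. The set $I_T(w)$ is a lower set of $\mathcal R_T$. *)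

(* Defs.v *)
From HB Require Import structures.
From mathcomp Require Import all_boot all_order all_fingroup.

Set Implicit Arguments.
Unset Strict Implicit.
Unset Printing Implicit Defensive.

(* Everything is indexed from 0: the values and positions of a permutation of
   'S_m are 0, ..., m - 1, the poset P_n consists of the pairs i < j in 'I_n,
   and k ranges over 'I_n.-1.  All formulas are the usual 1-based ones with
   every value, position and label shifted down by one. *)

Definition word (m : nat) (w : 'S_m) : seq nat :=
  [seq val (w p) | p <- enum 'I_m].

Definition Pn (n : nat) : {set 'I_n * 'I_n} := [set x : 'I_n * 'I_n | x.1 < x.2].

Definition Ple (n : nat) (x y : 'I_n * 'I_n) : bool :=
  (y.1 <= x.1) && (x.2 <= y.2).

Lemma ltnS_pred (n : nat) (k : 'I_n.-1) : k.+1 < n.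
Proof. by case: n k => [|n] [k]. Qed.

(* The pair (k, k + 1). *)
Definition adj (n : nat) (k : 'I_n.-1) : 'I_n * 'I_n :=
  (Ordinal (ltnW (ltnS_pred k)), Ordinal (ltnS_pred k)).

Definition Rperm (n : nat) (s : 'S_n.-1) (k : 'I_n.-1) : {set 'I_n * 'I_n} :=
  [set x in Pn n | Ple (adj k) x
    & [forall l : 'I_n.-1, (l < (s^-1)%g k) ==> ~~ Ple (adj (s l)) x]].

Inductive tree : Type :=
| Leaf
| Node (l : tree) (a : nat) (r : tree).

Fixpoint inorder (T : tree) : seq nat :=
  if T is Node l a r then inorder l ++ a :: inorder r else [::].

(* The set of binary trees with m internal nodes, labelled in in-order. *)
Definition labelled_trees (m : nat) : pred tree :=
  fun T => inorder T == iota 0 m.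

(* [is_bst T s] says that T is the binary search tree of the word s. *)
Fixpoint is_bst (T : tree) (s : seq nat) : bool :=
  match T, s with
  | Leaf, [::] => true
  | Node l a r, b :: s' =>
      [&& a == b, is_bst l [seq x <- s' | x < b] & is_bst r [seq x <- s' | b < x]]
  | _, _ => false
  end.

(* R_{T,k} is Rperm s k for any s whose binary search tree is T; see
   [bst_word_ex] and [RtreeE]. *)
Definition Rtree (n : nat) (T : tree) (k : 'I_n.-1) : {set 'I_n * 'I_n} :=
  [set x : 'I_n * 'I_n | [exists s : 'S_n.-1, is_bst T (word s) && (x \in Rperm s k)]].

Lemma size_word m (w : 'S_m) : size (word w) = m.
Proof. by rewrite size_map size_enum_ord. Qed.

Lemma nth_word m (w : 'S_m) (p : 'I_m) : nth 0 (word w) p = w p.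
Proof. by rewrite (nth_map p) ?size_enum_ord ?nth_ord_enum. Qed.

Lemma word_uniq m (w : 'S_m) : uniq (word w).
Proof.
rewrite map_inj_uniq ?enum_uniq // => x y /val_inj.
exact: perm_inj.
Qed.

Lemma index_word m (w : 'S_m) (a : 'I_m) : index (val a) (word w) = (w^-1)%g a.
Proof.
have := nth_word w ((w^-1)%g a); rewrite permKV /= => <-.
by rewrite index_uniq ?word_uniq ?size_word.
Qed.

Lemma mem_word m (w : 'S_m) (a : nat) : (a \in word w) = (a < m).
Proof.
apply/mapP/idP => [[p _ ->]|am]; first exact: ltn_ord.
by exists ((w^-1)%g (Ordinal am)); rewrite ?mem_enum ?permKV.
Qed.

(* The label closest to the root of T in the interval [i, j). *)
Fixpoint top_label (i j : nat) (T : tree) : option nat :=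
  if T is Node l a r then
    if a < i then top_label i j r
    else if j <= a then top_label i j l
    else Some a
  else None.

Lemma top_label_bst i j T s : is_bst T s ->
  ohead [seq x <- s | i <= x < j] = top_label i j T.
Proof.
elim: T s => [|l IHl a r IHr] [|b s] //= /and3P[/eqP <- /IHl Hl /IHr Hr].
rewrite -{}Hl -{}Hr; case: (ltnP a i) => [ai|ia] /=.
  rewrite -filter_predI; congr (ohead _); apply: eq_filter => x /=.
  by case: (ltnP a x) => [|xa]; rewrite ?andbT ?andbF // leqNgt (leq_ltn_trans xa ai).
case: (leqP j a) => //= ja.
rewrite -filter_predI; congr (ohead _); apply: eq_filter => x /=.
case: (ltnP x a) => [|xa]; rewrite ?andbT ?andbF //.
by rewrite [x < j]ltnNge (leq_trans ja xa) andbF.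
Qed.

Lemma in_RpermE n (s : 'S_n.-1) k x : (x \in Rperm s k) =
  (ohead [seq y <- word s | x.1 <= y < x.2] == Some (val k)).
Proof.
have kw : val k \in word s by rewrite mem_word ltn_ord.
have E : word s = take (index (val k) (word s)) (word s) ++
    val k :: drop (index (val k) (word s)).+1 (word s).
  rewrite -[X in X :: _](nth_index 0 kw) -drop_nth ?index_mem //.
  by rewrite cat_take_drop.
set p := fun y => x.1 <= y < x.2.
set t := take _ _ in E.
have tP : ~~ has p t =
    [forall l : 'I_n.-1, (l < (s^-1)%g k) ==> ~~ Ple (adj (s l)) x].
  have szt : size t = (s^-1)%g k by rewrite size_takel ?index_size ?index_word.
  apply/hasPn/forallP => [H l|H y].
    apply/implyP => lk; apply: (H (s l)).
    by rewrite -nth_word -(nth_take 0 (n0 := index (val k) (word s)))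
      ?index_word // -index_word mem_nth // szt.
  move=> /(nthP 0)[l]; rewrite szt => lk <-.
  have lm : l < n.-1 by apply: ltn_trans lk _.
  have := H (Ordinal lm); rewrite /= lk /=.
  by rewrite nth_take ?index_word // (nth_word s (Ordinal lm)).
have -> : (x \in Rperm s k) = p k && ~~ has p t.
  rewrite tP !inE; case: (boolP (Ple _ _)); rewrite /Ple /= => Pk.
    rewrite /p Pk /= (leq_ltn_trans (proj1 (andP Pk)) (proj2 (andP Pk))).
    by [].
  by rewrite /p (negbTE Pk) /= !andbF.
have kt : val k \notin t.
  have := word_uniq s; rewrite E cat_uniq /= => /and3P[_ + _].
  by rewrite negb_or => /andP[].
rewrite E filter_cat has_filter; rewrite -/p.
case F: (filter p t) => [|y q] /=; last first.
rewrite andbF; apply/esym/eqP => -[yk]; move: kt; rewrite /= -yk => /negP; apply.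
  by have := mem_head y q; rewrite -F mem_filter => /andP[].
rewrite andbT; case pk: (p k) => /=; first by rewrite eqxx.
apply/esym/eqP; case G: (filter p _) => [|y q] //= -[yk].
by have := mem_head y q; rewrite -G mem_filter yk pk.
Qed.

Lemma RtreeE n (T : tree) (s : 'S_n.-1) : is_bst T (word s) ->
  Rtree T =1 Rperm s.
Proof.
move=> Ts k; apply/setP => x; rewrite inE; apply/existsP/idP => [[s']|xs].
  by case/andP=> /top_label_bst H; rewrite !in_RpermE H -(top_label_bst _ _ Ts).
by exists s; rewrite Ts.
Qed.

Lemma word_of_seq m (s : seq nat) : perm_eq s (iota 0 m) ->
  exists w : 'S_m, word w = s.
Proof.
move=> sP; have sz : size s = m by rewrite (perm_size sP) size_iota.
have us : uniq s by rewrite (perm_uniq sP) iota_uniq.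
have lt (p : 'I_m) : nth 0 s p < m.
  have: nth 0 s p \in s by rewrite mem_nth ?sz.
  by rewrite (perm_mem sP) mem_iota.
have inj : injective (fun p => Ordinal (lt p)).
  move=> p q [] /eqP; rewrite nth_uniq ?sz // => /eqP; exact: val_inj.
exists (perm inj); apply: (@eq_from_nth _ 0); rewrite size_word ?sz // => i im.
by rewrite (nth_word _ (Ordinal im)) permE.
Qed.

Fixpoint preorder (T : tree) : seq nat :=
  if T is Node l a r then a :: preorder l ++ preorder r else [::].

Lemma preorder_perm T : perm_eq (preorder T) (inorder T).
Proof.
elim: T => //= l IHl a r IHr.
by rewrite perm_sym -[a :: inorder r]cat1s perm_catCA perm_cons perm_sym perm_cat.
Qed.

Lemma preorder_bst T : sorted ltn (inorder T) -> is_bst T (preorder T).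
Proof.
elim: T => //= l IHl a r IHr; rewrite (sorted_pairwise ltn_trans).
rewrite pairwise_cat /= allrel_consr -!andbA => /and5P[la lr pl ar pr].
rewrite eqxx !filter_cat /=.
have fl : all (fun x => x < a) (preorder l).
  by rewrite (perm_all _ (preorder_perm l)).
have fr : all (fun x => a < x) (preorder r).
  by rewrite (perm_all _ (preorder_perm r)).
have gl : ~~ has (fun x => a < x) (preorder l).
  by apply/hasPn => x /(allP fl); rewrite -leqNgt; apply: ltnW.
have gr : ~~ has (fun x => x < a) (preorder r).
  by apply/hasPn => x /(allP fr); rewrite -leqNgt; apply: ltnW.
rewrite (all_filterP fl) (all_filterP fr).
move: gl gr; rewrite !has_filter !negbK => /eqP-> /eqP->.
by rewrite cats0 IHl ?IHr ?(sorted_pairwise ltn_trans).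
Qed.

Lemma bst_word_ex m (T : tree) : labelled_trees m T ->
  exists s : 'S_m, is_bst T (word s).
Proof.
move=> /eqP mT; have [|s sE] := @word_of_seq m (preorder T).
  by rewrite -mT preorder_perm.
by exists s; rewrite sE preorder_bst // mT iota_ltn_sorted.
Qed.

Definition Rset (n : nat) (T : tree) : {set 'I_n * 'I_n} :=
  \bigcup_(k : 'I_n.-1) Rtree T k.

(* The order of the disjoint union: distinct parts are incomparable. *)
Definition Rle (n : nat) (T : tree) (x y : 'I_n * 'I_n) : bool :=
  [exists k : 'I_n.-1, [&& x \in Rtree T k, y \in Rtree T k & Ple x y]].

Definition lower_sets (n : nat) (T : tree) : {set {set 'I_n * 'I_n}} :=
  [set I : {set 'I_n * 'I_n} | (I \subset Rset n T) &&
    [forall y in I, forall x in Rset n T, Rle T x y ==> (x \in I)]].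

(* (i_{T,k}, j_{T,k}), the maximum of R_{T,k}; the default value is never used
   when T is in [labelled_trees n.-1], see [Rmax_spec]. *)
Definition Rmax (n : nat) (T : tree) (k : 'I_n.-1) : 'I_n * 'I_n :=
  odflt (adj k) [pick x in Rtree T k | [forall y in Rtree T k, Ple y x]].

Lemma adj_in_Rperm n (s : 'S_n.-1) (k : 'I_n.-1) : adj k \in Rperm s k.
Proof.
rewrite !inE /Ple /= ltnSn !leqnn /=; apply/forallP => l; apply/implyP => lk.
apply/negP; rewrite ltnS -eqn_leq => /eqP /val_inj kE.
by move: lk; rewrite kE permK ltnn.
Qed.

Lemma Rmax_spec n (T : tree) (k : 'I_n.-1) : labelled_trees n.-1 T ->
  Rmax T k \in Rtree T k /\ {in Rtree T k, forall y, Ple y (Rmax T k)}.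
Proof.
case/bst_word_ex => s /RtreeE RE; rewrite /Rmax; case: pickP => /= [x|noP].
  by case/andP => xR /forallP xP; split=> // y yR; have := xP y; rewrite yR.
exfalso; move: noP; rewrite !RE.
have [x xR xmin] := arg_minnP (fun x : 'I_n * 'I_n => x.1 : nat) (adj_in_Rperm s k).
have [y yR ymax] := arg_maxnP (fun x : 'I_n * 'I_n => x.2 : nat) (adj_in_Rperm s k).
move/(_ (x.1, y.2))/negP; apply; apply/andP; split; last first.
  by apply/forallP => z; apply/implyP => zR; rewrite /Ple /= xmin //; apply: ymax.
have {}xR : x \in Rperm s k by [].
have {}yR : y \in Rperm s k by [].
move: xR yR; rewrite !inE /Ple /=.
case/and3P=> _ /andP[x1k kx2] /forallP xP /and3P[_ /andP[y1k ky2] /forallP yP].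
rewrite x1k ky2 (leq_ltn_trans x1k ky2) /=; apply/forallP => l.
apply/implyP => lk; have := xP l; have := yP l; rewrite lk /=.
case: (leqP (s l) k) => [lek|/ltnW kle].
  by rewrite [_ < x.2](leq_trans _ kx2) // andbT => _ /negbTE->.
by rewrite (leq_trans y1k kle) /= => /negbTE->; rewrite andbF.
Qed.

Lemma Rtree_rect n (T : tree) (k : 'I_n.-1) x : labelled_trees n.-1 T ->
  (x \in Rtree T k) =
  ((Rmax T k).1 <= x.1 <= k) && (k.+1 <= x.2 <= (Rmax T k).2).
Proof.
move=> hT; have [mR mmax] := Rmax_spec k hT.
apply/idP/andP => [xR|[/andP[mx xk] /andP[kx xm]]].
  have /andP[-> ->] := mmax _ xR.
  case/bst_word_ex: hT => s /RtreeE RE; move: xR; rewrite RE !inE.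
  by case/and3P=> _ /andP[-> ->] _.
case/bst_word_ex: hT => s /RtreeE RE; move: mR; rewrite !RE !inE.
case/and3P=> _ _ /forallP mP; rewrite /Ple /= xk kx (leq_ltn_trans xk kx) /=.
apply/forallP => l; apply/implyP => lk; have := mP l; rewrite lk /=.
apply: contra => /andP[xl lx].
by rewrite /Ple /= (leq_trans mx xl) (leq_trans lx xm).
Qed.

Definition wL (n : nat) (T : tree) (k : 'I_n.-1) (w : 'S_n) : seq nat :=
  [seq x <- word w | (Rmax T k).1 <= x <= k].

Definition wR (n : nat) (T : tree) (k : 'I_n.-1) (w : 'S_n) : seq nat :=
  [seq x <- word w | k.+1 <= x <= (Rmax T k).2].

Definition appears_after (n : nat) (w : 'S_n) (a b : nat) : bool :=
  index b (word w) < index a (word w).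

(* The position i - i_{T,k} + 1 counted from 1 is i - i_{T,k} counted from 0,
   and j - k counted from 1 is j - (k + 1) counted from 0; both are in range
   for (i, j) in R_{T,k}, which is a rectangle by [Rtree_rect]. *)
Definition IT (n : nat) (T : tree) (w : 'S_n) : {set 'I_n * 'I_n} :=
  [set x : 'I_n * 'I_n | [exists k : 'I_n.-1, (x \in Rtree T k) &&
     appears_after w (nth 0 (wL T k w) (x.1 - (Rmax T k).1))
                     (nth 0 (wR T k w) (x.2 - k.+1))]].

Definition leT (n : nat) (T : tree) : rel 'S_n :=
  fun v w => IT T v \subset IT T w.

(* r is the order of some distributive lattice structure with carrier X; the
   display of that structure is immaterial. *)
Definition is_distributive_lattice (X : Type) (r : rel X) : Prop :=
  exists c : Order.DistrLattice.axioms_ (Order.Disp tt tt) X,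
    forall x y : X, r x y = (x <= y :> Order.DistrLattice.Pack c)%O.

(* Main.v *)
(** The root k of T has R_{T,k} = [1,k] x [k+1,n], so w is a shuffle of its
    subwords of values <= k and > k, and I_T(w) restricted to R_{T,k} records
    which letters of the first subword come after which letters of the second.
    Shuffles of two fixed words correspond in this way to the lower sets of a
    rectangle.  The two subwords are arbitrary and are treated recursively by
    the two subtrees, because the relative order of two letters of w can be
    read off any subword containing both.  Lower sets of R_T are closed under
    union and intersection, so the bijection transports their distributive
    lattice structure to the permutations. *)

Require Import Defs.
From HB Require Import structures.
From mathcomp Require Import all_boot all_order all_fingroup zify.

Set Implicit Arguments.
Unset Strict Implicit.
Unset Printing Implicit Defensive.

(** * Shuffles of two words *)

(** Used to read the relative order of two letters off a subword. A letter absent from [u] causes no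
    trouble: its index is the length of the word searched, on both sides. *)
Lemma index_filter_lt (T : eqType) (P : pred T) (u : seq T) (a b : T) :
  P a -> P b ->
  (index a (filter P u) < index b (filter P u)) = (index a u < index b u).
Proof.
move=> Pa Pb; elim: u => //= z u IH; case Pz: (P z) => /=.
  by case: (z == a); case: (z == b); rewrite // !ltnS.
rewrite IH; case: eqP => [za|_]; first by rewrite za Pa in Pz.
by case: eqP => [zb|_]; first by rewrite zb Pb in Pz.
Qed.

(* The order on pairs is that of the poset P_n: decreasing in the first index,
   increasing in the second. *)
Lemma shuffle_ex (X : eqType) (x0 : X) (P : pred X) (I : nat -> nat -> bool)
    (s t : seq X) :
  uniq s -> uniq t -> all P s -> all (predC P) t ->
  (forall c d c' d', c <= c' < size s -> d' <= d < size t -> I c d -> I c' d') ->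
  exists u, [/\ filter P u = s, filter (predC P) u = t, perm_eq u (s ++ t) &
    forall c d, c < size s -> d < size t ->
      (index (nth x0 t d) u < index (nth x0 s c) u) = I c d].
Proof.
have filter0 (Q : pred X) r : all (predC Q) r -> filter Q r = [::].
  by move=> Qr; apply/eqP; rewrite -[_ == _]negbK -has_filter -all_predC.
elim: s t I => [|x s IHs] t I /=.
  move=> _ _ _ Pt _; exists t; split=> //; last exact/all_filterP.
  exact: filter0.
case/andP=> xs us + /andP[Px Ps].
elim: t I => [|y t IHt] I /=.
  move=> _ _ _; exists (x :: s); split; rewrite ?cats0 //=.
    by rewrite Px (all_filterP Ps).
  rewrite Px /=; apply: filter0; apply: sub_all Ps => z Pz.
  by rewrite /= Pz.
case/andP=> yt ut /andP[nPy nPt] I_lower.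
have yx : y != x by apply: contraNneq nPy => ->.
have sx c : c < size s -> x == nth x0 s c = false.
  by move=> cs; apply: contraNF xs => /eqP->; apply: mem_nth.
have ty d : d < size t -> y == nth x0 t d = false.
  by move=> dt; apply: contraNF yt => /eqP->; apply: mem_nth.
have sy c : c < size s -> y == nth x0 s c = false.
  by move=> cs; apply: contraNF nPy => /eqP->; apply: (allP Ps); apply: mem_nth.
have tx d : d < size t -> x == nth x0 t d = false.
  move=> dt; apply/eqP => xE; have := allP nPt _ (mem_nth x0 dt).
  by rewrite /= -xE Px.
(* The first letters are merged greedily. If [I 0 0] holds, then so does [I c 0] for every [c], and
   [y] goes before all of [x :: s]; otherwise [I 0 d] fails for every [d], and [x] goes before all
   of [y :: t]. The rest is a shuffle for [I] shifted by one in the coordinate of the letter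
   removed. *)
case I00: (I 0 0).
  have [|u [fs ft up uI]] := IHt (fun c d => I c d.+1) ut nPt.
    by move=> c d c' d' cc dd; apply: (I_lower c d.+1 c' d'.+1 cc dd).
  exists (y :: u); split=> /=.
  - by rewrite (negbTE nPy).
  - by rewrite nPy ft.
  - by rewrite perm_sym -[y :: t]cat1s -cat_cons perm_catCA /= perm_cons perm_sym.
  move=> c [|d] cs dt /=; rewrite ?eqxx.
    have -> : y == nth x0 (x :: s) c = false.
      by case: c cs => [|c] cs /=; rewrite ?(negbTE yx) ?sy.
    by rewrite ltn0Sn; apply/esym; apply: (I_lower 0 0 c 0 cs isT I00).
  rewrite ty //.
  have -> : y == nth x0 (x :: s) c = false.
    by case: c cs => [|c] cs /=; rewrite ?(negbTE yx) ?sy.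
  by rewrite ltnS uI.
have [| | | |u [fs ft up uI]] := IHs (y :: t) (fun c d => I c.+1 d) us => //=.
- by rewrite yt.
- by rewrite nPy.
- by move=> c d c' d' cc dd; apply: (I_lower c.+1 d c'.+1 d' cc dd).
exists (x :: u); split=> /=.
- by rewrite Px fs.
- by rewrite Px.
- by rewrite perm_cons.
move=> [|c] d cs dt /=; rewrite ?eqxx.
  by rewrite ltn0; apply/esym; apply: contraFF I00; apply: (I_lower 0 d 0 0 isT dt).
rewrite sx //.
have -> : x == nth x0 (y :: t) d = false.
  by case: d dt => [|d] dt /=; rewrite ?tx // eq_sym (negbTE yx).
by rewrite ltnS uI.
Qed.

(** If the words start with different letters, equality of the subwords forces exactly one of these
    letters to satisfy [P]. Each then comes first in its own word, so [u] and [v] disagree on the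
    order of this pair. *)
Lemma shuffle_inj (X : eqType) (P : pred X) (u v : seq X) : uniq u ->
  filter P u = filter P v -> filter (predC P) u = filter (predC P) v ->
  (forall x y, x \in u -> P x -> y \in u -> ~~ P y ->
     (index y u < index x u) = (index y v < index x v)) ->
  u = v.
Proof.
elim: u v => [|x u IH] [|y v] //=.
- by case: (P y).
- by case: (P x).
case/andP=> xu uu fP fN uv; have xy : x = y.
  case: (eqVneq x y) => // nxy; move: (nxy); rewrite eq_sym => nyx.
  case Px: (P x); case Py: (P y); move: fP fN; rewrite Px Py //=.
  - by case.
  - move=> _ yE; have := uv x y; rewrite !inE eqxx Px Py.
    have -> : y \in u.
      by have := mem_head y (filter (predC P) v); rewrite -yE mem_filter => /andP[].
    by rewrite !eqxx ?(negbTE nxy) ?(negbTE nyx) => /(_ isT isT isT isT).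
  - move=> yE _; have := uv y x; rewrite !inE eqxx Px Py.
    have -> : y \in u.
      by have := mem_head y (filter P v); rewrite -yE mem_filter => /andP[].
    by rewrite !eqxx ?(negbTE nxy) ?(negbTE nyx) => /(_ isT isT isT isT).
  - by move=> _ [].
subst y; congr cons; apply: IH => //.
- by move: fP; case: (P x) => // -[].
- by move: fN; case: (P x) => //= -[].
have nx z : z \in u -> x == z = false by move=> zu; apply: contraNF xu => /eqP->.
by move=> a b au Pa bu Pb; have := uv a b; rewrite !inE au bu !orbT !nx //= !ltnS => ->.
Qed.

(** * Crossings at the nodes of a tree *)

(* The triples (i_{T,k}, k, j_{T,k}), for T with labels i, ..., j - 1. *)
Fixpoint nodes (i j : nat) (T : tree) : seq (nat * nat * nat) :=
  if T is Node l a r then nodes i a l ++ (i, a, j) :: nodes a.+1 j r else [::].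

(** A tree with labels i, ..., j - 1 acts on words in the letters i, ..., j, one more than its
    labels. *)
Definition interval_word (i j : nat) (u : seq nat) : bool :=
  perm_eq u (iota i (j.+1 - i)).

(* The condition defining (x, y) \in I_T(u), for a node (i, k, j) of T. *)
Definition crosses (u : seq nat) (i k j x y : nat) : bool :=
  index (nth 0 [seq z <- u | k < z <= j] (y - k.+1)) u
    < index (nth 0 [seq z <- u | i <= z <= k] (x - i)) u.

Lemma inorder_node i j l a r : i <= j -> inorder (Node l a r) = iota i (j - i) ->
  [/\ i <= a < j, inorder l = iota i (a - i) & inorder r = iota a.+1 (j - a.+1)].
Proof.
move=> ij /= E; have sz : size (inorder l) < j - i.
  by have := congr1 size E; rewrite size_cat size_iota /=; lia.
have aE : a = i + size (inorder l).
  have := congr1 (nth 0 ^~ (size (inorder l))) E.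
  by rewrite nth_cat ltnn subnn /= nth_iota.
have E1 : inorder l = iota i (a - i).
  have := congr1 (take (size (inorder l))) E.
  by rewrite take_size_cat // take_iota => ->; congr iota; lia.
split=> //; first by lia.
have := congr1 (drop (size (inorder l)).+1) E.
rewrite drop_cat ltnNge leqnSn /= subSn // subnn /= drop0 drop_iota => ->.
by congr iota; lia.
Qed.

Lemma nodes_label i j T : [seq p.1.2 | p <- nodes i j T] = inorder T.
Proof. by elim: T i j => //= l IHl a r IHr i j; rewrite map_cat /= IHl IHr. Qed.

Lemma nodes_bounds i j T i' k j' : i <= j -> inorder T = iota i (j - i) ->
  (i', k, j') \in nodes i j T -> i <= i' <= k /\ k < j' <= j.
Proof.
elim: T i j => //= l IHl a r IHr i j ij /(inorder_node ij)[ai El Er].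
rewrite mem_cat inE => /or3P[kl|/eqP[-> -> ->]|kr]; last 1 first.
- by have [|b1 b2] := IHr _ _ _ Er kr; lia.
- by have [|b1 b2] := IHl _ _ _ El kl; lia.
- lia.
Qed.

Lemma top_label_mem i j T k : top_label i j T = Some k -> k \in inorder T.
Proof.
elim: T => //= l IHl a r IHr; rewrite mem_cat inE.
case: ifP => _; first by move/IHr->; rewrite !orbT.
by case: ifP => _; [move/IHl-> | case=> ->; rewrite eqxx orbT].
Qed.

(** The search ends at [k] exactly when [k] lies in [x, y) and no ancestor of [k] does. The closest
    ancestors of [k] below and above it are i' - 1 and j', or the ends i and j stand in for them, so
    the condition becomes i' <= x and y <= j'. *)
Lemma top_label_node i j T i' k j' x y : i <= j -> inorder T = iota i (j - i) ->
  (i', k, j') \in nodes i j T -> i <= x -> y <= j ->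
  (top_label x y T == Some k) = (i' <= x <= k) && (k < y <= j').
Proof.
elim: T i j => //= l IHl a r IHr i j ij /(inorder_node ij)[ai El Er].
have outside T0 i0 j0 : inorder T0 = iota i0 (j0 - i0) -> ~~ (i0 <= k < j0) ->
    top_label x y T0 == Some k = false.
  move=> E0 k0; apply: contraNF k0 => /eqP/top_label_mem.
  by rewrite E0 mem_iota; lia.
rewrite mem_cat inE => /or3P[kl|/eqP[? ? ?]|kr] ix yj; try subst i' k j'.
- have [|b1 b2] := nodes_bounds _ El kl; first lia.
  case: (ltnP a x) => xa; first by (rewrite (outside _ _ _ Er) //; lia).
  case: (leqP y a) => ya; first by (apply: (IHl i a) => //; lia).
  have -> : (Some a == Some k) = (a == k) by [].
  by lia.
- case: (ltnP a x) => xa; first by (rewrite (outside _ _ _ Er) //; lia).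
  case: (leqP y a) => ya; first by (rewrite (outside _ _ _ El) //; lia).
  by rewrite eqxx; lia.
- have [|b1 b2] := nodes_bounds _ Er kr; first lia.
  case: (ltnP a x) => xa; first by (apply: (IHr a.+1 j) => //; lia).
  case: (leqP y a) => ya; first by (rewrite (outside _ _ _ El) //; lia).
  have -> : (Some a == Some k) = (a == k) by [].
  by lia.
Qed.

Lemma interval_word_uniq i j u : interval_word i j u -> uniq u.
Proof. by move/perm_uniq->; apply: iota_uniq. Qed.

Lemma mem_interval_word i j u z : i <= j.+1 -> interval_word i j u ->
  (z \in u) = (i <= z <= j).
Proof. by move=> ij /perm_mem->; rewrite mem_iota; lia. Qed.

Lemma interval_word_filter i j i' j' u : i <= i' -> i' <= j'.+1 -> j' <= j ->
  interval_word i j u -> interval_word i' j' [seq z <- u | i' <= z <= j'].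
Proof.
move=> ii ij jj uP; apply: uniq_perm; rewrite ?iota_uniq ?filter_uniq //.
  exact: interval_word_uniq uP.
move=> z; rewrite mem_filter (mem_interval_word _ _ uP) ?mem_iota; lia.
Qed.

Lemma size_interval_word i j u : interval_word i j u -> size u = j.+1 - i.
Proof. by move/perm_size->; rewrite size_iota. Qed.

(** All letters compared at the node lie in [i, j], hence satisfy [P]: filtering changes neither the
    two subwords nor the order between their letters. This is what makes recursion on subtrees
    possible. *)
Lemma crosses_filter (P : pred nat) i0 j0 u i k j x y :
  interval_word i0 j0 u -> i0 <= i -> j <= j0 ->
  (forall z, i <= z <= j -> P z) -> i <= x <= k -> k < y <= j ->
  crosses (filter P u) i k j x y = crosses u i k j x y.
Proof.
move=> uP ii jj PP xb yb; rewrite /crosses -!filter_predI.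
have fE i' j' : i <= i' -> j' <= j ->
    [seq z <- u | predI (fun z => i' <= z <= j') P z] = [seq z <- u | i' <= z <= j'].
  move=> ii' jj'; apply: eq_filter => z /=.
  by case: (boolP (i' <= z <= j')) => //= zb; apply: PP; lia.
rewrite (fE k.+1 j) ?(fE i k); try lia.
(* The bound on [c] keeps [nth] away from its default 0, at which [P] may fail. *)
have nthP i' j' c : i <= i' -> i' <= j'.+1 -> j' <= j -> c < j'.+1 - i' ->
    P (nth 0 [seq z <- u | i' <= z <= j'] c).
  move=> ii' ij' jj' cb; have fP : interval_word i' j' [seq z <- u | i' <= z <= j'].
    by apply: interval_word_filter uP; lia.
  have := @mem_nth _ 0 [seq z <- u | i' <= z <= j'] c.
  rewrite (size_interval_word fP) (mem_interval_word _ ij' fP) => /(_ cb)/andP[lo hi].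
  by apply: PP; rewrite (leq_trans ii' lo) (leq_trans hi jj').
by apply: index_filter_lt; apply: nthP; lia.
Qed.

(** Raising x picks a later letter of the left subword, and lowering y an earlier letter of the
    right one, so a crossing persists. *)
Lemma crosses_lower i0 j0 u i k j x y x' y' :
  interval_word i0 j0 u -> i0 <= i -> j <= j0 ->
  i <= x -> x <= x' <= k -> k < y' <= y -> y <= j ->
  crosses u i k j x y -> crosses u i k j x' y'.
Proof.
move=> uP ii jj ix xx yy yj; rewrite /crosses.
have mono i' j' c d : i0 <= i' -> i' <= j'.+1 -> j' <= j0 -> c <= d < j'.+1 - i' ->
    index (nth 0 [seq z <- u | i' <= z <= j'] c) u
      <= index (nth 0 [seq z <- u | i' <= z <= j'] d) u.
  move=> ii' ij' jj' cd; have fP : interval_word i' j' [seq z <- u | i' <= z <= j'].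
    by apply: interval_word_filter uP; lia.
  have sz := size_interval_word fP.
  have Q e : e < j'.+1 - i' -> i' <= nth 0 [seq z <- u | i' <= z <= j'] e <= j'.
    by move=> eb; rewrite -(mem_interval_word _ _ fP) ?mem_nth ?sz; lia.
  (* Inside the filtered word the index of the letter at position [c] is [c] itself. *)
  rewrite leqNgt -(index_filter_lt (P := fun z => i' <= z <= j')) ?Q //; try lia.
  rewrite !index_uniq ?sz ?(interval_word_uniq fP) //; lia.
move=> lt; apply: leq_ltn_trans (mono k.+1 j (y' - k.+1) (y - k.+1) _ _ _ _) _; try lia.
apply: leq_trans lt (mono i k (x - i) (x' - i) _ _ _ _); lia.
Qed.

Definition same_crossings (u : seq nat) (I : nat -> nat -> bool) (p : nat * nat * nat) :=
  forall x y, p.1.1 <= x <= p.1.2 -> p.1.2 < y <= p.2 ->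
    crosses u p.1.1 p.1.2 p.2 x y = I x y.

Definition lower_on (I : nat -> nat -> bool) (p : nat * nat * nat) :=
  forall x y x' y', p.1.1 <= x -> x <= x' <= p.1.2 -> p.1.2 < y' <= y -> y <= p.2 ->
    I x y -> I x' y'.

(** The subtrees provide the words on [i, a] and [a + 1, j], and [I] on the rectangle of the root
    tells how to shuffle them. Both words are recovered by filtering the shuffle, so the crossings
    at the other nodes are kept. *)
Lemma crossings_surj i j T (I : nat -> nat -> bool) : i <= j ->
  inorder T = iota i (j - i) ->
  (forall p, p \in nodes i j T -> lower_on I p) ->
  exists2 u, interval_word i j u & forall p, p \in nodes i j T -> same_crossings u I p.
Proof.
elim: T i j => [|l IHl a r IHr] i j ij E Ilow.
  exists [:: i] => //; rewrite /interval_word.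
  have := congr1 size E; rewrite size_iota /= => ji.
  by have -> : j.+1 - i = 1 by lia.
have [ai El Er] := inorder_node ij E.
have ia : i <= a by lia.
have aj : a.+1 <= j by lia.
have [|s sP sI] := IHl i a ia El => [p pl|].
  by apply: Ilow; rewrite /= mem_cat pl.
have [|t tP tI] := IHr a.+1 j aj Er => [p pr|].
  by apply: Ilow; rewrite /= mem_cat inE pr !orbT.
have alls : all (fun z => z <= a) s.
  by apply/allP => z; rewrite (mem_interval_word _ _ sP); lia.
have allt : all (predC (fun z => z <= a)) t.
  by apply/allP => z; rewrite (mem_interval_word _ _ tP) /=; lia.
have [ss st] := (size_interval_word sP, size_interval_word tP).
(* The rectangle of the root is re-indexed by positions in [s] and [t], both counted from 0. *)
have [|u [us ut up uI]] :=
  shuffle_ex (I := fun c d => I (i + c) (a.+1 + d)) 0 (interval_word_uniq sP)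
    (interval_word_uniq tP) alls allt.
  move=> c d c' d'; rewrite ss st => cc dd.
  by apply: (Ilow (i, a, j)); rewrite /= ?mem_cat ?mem_head ?orbT //; lia.
have uP : interval_word i j u.
  apply: (perm_trans up); apply: (perm_trans (perm_cat sP tP)).
  have -> : j.+1 - i = (a.+1 - i) + (j.+1 - a.+1) by lia.
  by rewrite iotaD (_ : i + (a.+1 - i) = a.+1) //; lia.
have fE (Q R : pred nat) : {in u, Q =1 R} -> filter Q u = filter R u.
  by move=> QR; apply: eq_in_filter.
exists u => // -[[i' k] j'] pT.
move: pT; rewrite /= mem_cat inE => /or3P[pl|/eqP[-> -> ->]|pr] x y /= xb yb.
- have [|b1 b2] := nodes_bounds _ El pl; first lia.
  rewrite -(sI _ pl) //= -us; apply/esym; apply: (crosses_filter uP) => //; lia.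
- have ltE : [seq z <- u | z <= a] = [seq z <- u | i <= z <= a].
    by apply: fE => z; rewrite (mem_interval_word _ _ uP); lia.
  have gtE : filter (predC (fun z => z <= a)) u = [seq z <- u | a < z <= j].
    by apply: fE => z; rewrite (mem_interval_word _ _ uP) /=; lia.
  rewrite /crosses -ltE -gtE us ut uI ?ss ?st; try lia.
  by congr I; lia.
- have [|b1 b2] := nodes_bounds _ Er pr; first lia.
  rewrite -(tI _ pr) //= -ut; apply/esym; apply: (crosses_filter uP) => //=; lia.
Qed.

(** By induction [u] and [v] have the same subwords on [i, a] and [a + 1, j]; the crossings at the
    root then fix the order of every pair of letters across, and [shuffle_inj] applies. *)
Lemma crossings_inj i j T u v : i <= j -> inorder T = iota i (j - i) ->
  interval_word i j u -> interval_word i j v ->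
  (forall i' k j', (i', k, j') \in nodes i j T ->
     same_crossings u (crosses v i' k j') (i', k, j')) ->
  u = v.
Proof.
elim: T i j u v => [|l IHl a r IHr] i j u v ij E uP vP uv.
  have jE : j.+1 - i = 1 by have := congr1 size E; rewrite size_iota /=; lia.
  have single w : interval_word i j w -> w = [:: i].
    by rewrite /interval_word jE => /perm_small_eq->.
  by rewrite (single _ uP) (single _ vP).
have [ai El Er] := inorder_node ij E.
(* Restricting both words to an interval containing [i', j'] preserves the agreement at that node,
   which is the hypothesis needed for each subtree. *)
have sub i1 j1 : i <= i1 -> i1 <= j1 -> j1 <= j -> forall i' k j',
   (i', k, j') \in nodes i j (Node l a r) -> i1 <= i' -> j' <= j1 ->
   same_crossings [seq z <- u | i1 <= z <= j1]
     (crosses [seq z <- v | i1 <= z <= j1] i' k j') (i', k, j').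
  move=> ii1 ij1 jj1 i' k j' kT ii' jj' x y /= xb yb.
  rewrite (crosses_filter uP) ?(crosses_filter vP); try lia.
  exact: (uv _ _ _ kT).
have fl : [seq z <- u | i <= z <= a] = [seq z <- v | i <= z <= a].
  apply: (IHl i a) => //; try by [lia | apply: interval_word_filter uP; lia
    | apply: interval_word_filter vP; lia].
  move=> i' k j' kl; have [|b1 b2] := nodes_bounds _ El kl; first lia.
  by apply: sub; rewrite ?mem_cat ?kl //; lia.
have fr : [seq z <- u | a.+1 <= z <= j] = [seq z <- v | a.+1 <= z <= j].
  apply: (IHr a.+1 j) => //; try by [lia | apply: interval_word_filter uP; lia
    | apply: interval_word_filter vP; lia].
  move=> i' k j' kr; have [|b1 b2] := nodes_bounds _ Er kr; first lia.
  by apply: sub; rewrite ?mem_cat ?inE ?kr ?orbT //; lia.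
have leE w : interval_word i j w ->
    [seq z <- w | z <= a] = [seq z <- w | i <= z <= a].
  move=> wP; apply: eq_in_filter => z; rewrite (mem_interval_word _ _ wP); lia.
have gtE w : interval_word i j w ->
    filter (predC (fun z => z <= a)) w = [seq z <- w | a < z <= j].
  move=> wP; apply: eq_in_filter => z; rewrite (mem_interval_word _ _ wP) /=; lia.
apply: (@shuffle_inj _ (fun z => z <= a)).
- exact: interval_word_uniq uP.
- by rewrite !leE.
- by rewrite !gtE.
move=> x y xu xa yu ya.
have lP : interval_word i a [seq z <- u | i <= z <= a].
  by apply: interval_word_filter uP; lia.
have rP : interval_word a.+1 j [seq z <- u | a.+1 <= z <= j].
  by apply: interval_word_filter uP; lia.
have xl : x \in [seq z <- u | i <= z <= a] by rewrite -leE // mem_filter xa.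
have yr : y \in [seq z <- u | a.+1 <= z <= j] by rewrite -gtE // mem_filter /= ya.
have xs := size_interval_word lP; have ys := size_interval_word rP.
move: (xl) (yr); rewrite -!index_mem xs ys => xi yi.
(* The coordinates are the ranks of [x] and [y] in their subwords, so the crossing at the root
   compares exactly these two letters. *)
have := uv i a j _ (i + index x [seq z <- u | i <= z <= a])
  (a.+1 + index y [seq z <- u | a.+1 <= z <= j]).
rewrite /= mem_cat mem_head orbT /crosses !addKn -fl -fr !nth_index //.
by apply=> //; lia.
Qed.

(** * The map I_T and the lower sets of R_T *)

Lemma in_Rtree n T (k : 'I_n.-1) x : labelled_trees n.-1 T ->
  (x \in Rtree T k) = (top_label x.1 x.2 T == Some (val k)).
Proof.
case/bst_word_ex => s Ts.
by rewrite (RtreeE Ts) in_RpermE (top_label_bst _ _ Ts).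
Qed.

Section CrossingSets.
Variables (m : nat) (T : tree).
Hypothesis hT : labelled_trees m T.

(** The form [m - 0] matches the pattern [iota i (j - i)] of the lemmas on nodes. *)
Let inorderT : inorder T = iota 0 (m - 0).
Proof. by rewrite subn0; apply/eqP. Qed.

Lemma in_Rtree_node (k : 'I_m) i j (x : 'I_m.+1 * 'I_m.+1) :
  (i, k : nat, j) \in nodes 0 m T ->
  (x \in @Rtree m.+1 T k) = (i <= x.1 <= k) && (k < x.2 <= j).
Proof.
move=> kT; rewrite (@in_Rtree m.+1) //.
by rewrite (top_label_node _ inorderT kT) // -ltnS ltn_ord.
Qed.

Lemma node_ex (k : 'I_m) : exists i j, (i, k : nat, j) \in nodes 0 m T.
Proof.
have: (k : nat) \in inorder T by rewrite inorderT mem_iota subn0 /=.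
by rewrite -(nodes_label 0 m) => /mapP[[[i k'] j] /= kT ->]; exists i, j.
Qed.

Lemma Rmax_node (k : 'I_m) i j : (i, k : nat, j) \in nodes 0 m T ->
  (@Rmax m.+1 T k).1 = i :> nat /\ (@Rmax m.+1 T k).2 = j :> nat.
Proof.
move=> kT; have [//|b1 b2] := nodes_bounds _ inorderT kT.
have [] := @Rmax_spec m.+1 T k hT.
rewrite (in_Rtree_node _ kT) => maxb maxP.
have im : i < m.+1 by lia.
have jm : j < m.+1 by lia.
(* The corner (i, j) lies below the maximum, and the maximum lies in the rectangle; together these
   force both coordinates. *)
have : Ple (Ordinal im, Ordinal jm) (@Rmax m.+1 T k).
  by apply: maxP; rewrite (in_Rtree_node _ kT) /=; lia.
by move: maxb; rewrite /Ple /=; split; lia.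
Qed.

Lemma in_IT w (k : 'I_m) i j (x : 'I_m.+1 * 'I_m.+1) :
  (i, k : nat, j) \in nodes 0 m T -> x \in @Rtree m.+1 T k ->
  (x \in IT T w) = crosses (word w) i k j x.1 x.2.
Proof.
move=> kT xk; have [<- <-] := Rmax_node kT.
rewrite inE; apply/existsP/idP => [[k' /andP[xk' xw]]|xw]; last by exists k; rewrite xk.
(* The part containing [x] is unique, its label being the top label of [x.1, x.2). *)
move: xk xk'; rewrite !(@in_Rtree m.+1) // => /eqP-> /eqP[kk'].
by rewrite (val_inj kk').
Qed.

Lemma IT_subset (w : 'S_m.+1) : IT T w \subset Rset m.+1 T.
Proof.
apply/subsetP => x; rewrite inE => /existsP[k /andP[xk _]].
by apply/bigcupP; exists k.
Qed.

Lemma interval_word_perm (w : 'S_m.+1) : interval_word 0 m (word w).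
Proof.
apply: uniq_perm; rewrite ?word_uniq ?iota_uniq // => z.
by rewrite mem_word mem_iota.
Qed.

Lemma IT_lower (w : 'S_m.+1) : IT T w \in lower_sets m.+1 T.
Proof.
rewrite inE IT_subset /=; apply/forallP => y; apply/implyP => yw.
apply/forallP => x; apply/implyP => _; apply/implyP.
case/existsP => k /and3P[xk yk /andP[xy1 xy2]].
have [i [j kT]] := node_ex k.
move: yw; rewrite (in_IT _ kT xk) (in_IT _ kT yk).
move: xk yk; rewrite !(in_Rtree_node _ kT) => xk yk.
have [//|b1 b2] := nodes_bounds _ inorderT kT.
by apply: (crosses_lower (interval_word_perm w)); lia.
Qed.

Lemma IT_inj : injective (@IT m.+1 T).
Proof.
move=> v w vw; suff E : word v = word w.
  by apply/permP => p; apply: val_inj; rewrite /= -!nth_word E.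
apply: (crossings_inj _ inorderT); rewrite ?interval_word_perm //.
move=> i k j kT x y /= xb yb.
have [//|b1 b2] := nodes_bounds _ inorderT kT.
have km : k < m by lia.
have xm : x < m.+1 by lia.
have ym : y < m.+1 by lia.
have kT' : (i, Ordinal km : nat, j) \in nodes 0 m T by [].
have xk : (Ordinal xm, Ordinal ym) \in @Rtree m.+1 T (Ordinal km).
  by rewrite (in_Rtree_node _ kT') /= xb yb.
by have := in_IT v kT' xk; rewrite vw (in_IT w kT' xk) => <-.
Qed.

Lemma IT_surj I : I \in lower_sets m.+1 T -> exists w : 'S_m.+1, IT T w = I.
Proof.
rewrite inE => /andP[/subsetP IR /forallP I_lower].
(* [inord] extends [I] to all naturals; [J] is used only at points of R_T, whose coordinates are at
   most m, where [inord] is exact. *)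
pose J x y := (inord x, inord y) \in I.
have [//||u uP uJ] := @crossings_surj 0 m T J _ inorderT.
  move=> [[i k] j] kT x y x' y' /= ix xx yy yj.
  have [//|b1 b2] := nodes_bounds _ inorderT kT.
  have km : k < m by lia.
  have kT' : (i, Ordinal km : nat, j) \in nodes 0 m T by [].
  have inR a b : i <= a <= k -> k < b <= j ->
      (inord a, inord b) \in @Rtree m.+1 T (Ordinal km).
    by move=> ak bk; rewrite (in_Rtree_node _ kT') /= !inordK; lia.
  have R' : (inord x', inord y') \in @Rtree m.+1 T (Ordinal km) by apply: inR; lia.
  have R : (inord x, inord y) \in @Rtree m.+1 T (Ordinal km) by apply: inR; lia.
  move=> Jxy; have /implyP/(_ Jxy)/forallP/(_ (inord x', inord y')) :=
    I_lower (inord x, inord y).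
  have -> : (inord x', inord y') \in Rset m.+1 T by apply/bigcupP; exists (Ordinal km).
  move=> /implyP/(_ isT)/implyP; apply; apply/existsP; exists (Ordinal km).
  by rewrite R' R /Ple /= !inordK; lia.
have [w wu] := word_of_seq uP; exists w; apply/setP => x.
case: (boolP (x \in Rset m.+1 T)) => [/bigcupP[k _ xk]|xR]; last first.
  have -> : x \in IT T w = false.
    by apply: contraNF xR; apply: (subsetP (IT_subset w)).
  by apply/esym; apply: contraNF xR; apply: IR.
have [i [j kT]] := node_ex k.
rewrite (in_IT _ kT xk) wu (uJ _ kT).
- by rewrite /J !inord_val; case: x {xk}.
- by move: xk; rewrite (in_Rtree_node _ kT) => /andP[].
- by move: xk; rewrite (in_Rtree_node _ kT) => /andP[].
Qed.
End CrossingSets.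

(** * Distributive lattice structure *)

Lemma lower_setsI n T (I J : {set 'I_n * 'I_n}) :
  I \in lower_sets n T -> J \in lower_sets n T -> I :&: J \in lower_sets n T.
Proof.
rewrite !inE => /andP[IR /forall_inP Il] /andP[JR /forall_inP Jl].
rewrite (subset_trans (subsetIl I J)) //=; apply/forall_inP => y /setIP[yI yJ].
apply/forall_inP => x xR; apply/implyP => xy; rewrite inE.
have /forall_inP/(_ x xR)/implyP/(_ xy)-> := Il y yI.
by have /forall_inP/(_ x xR)/implyP/(_ xy)-> := Jl y yJ.
Qed.

Lemma lower_setsU n T (I J : {set 'I_n * 'I_n}) :
  I \in lower_sets n T -> J \in lower_sets n T -> I :|: J \in lower_sets n T.
Proof.
rewrite !inE => /andP[IR /forall_inP Il] /andP[JR /forall_inP Jl].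
rewrite subUset IR JR /=; apply/forall_inP => y /setUP[yI|yJ];
  apply/forall_inP => x xR; apply/implyP => xy; rewrite inE.
- by have /forall_inP/(_ x xR)/implyP/(_ xy)-> := Il y yI.
- by have /forall_inP/(_ x xR)/implyP/(_ xy)-> := Jl y yJ; rewrite orbT.
Qed.

(** Since [f] is injective and turns [meet] and [join] into intersection and union, every lattice
    identity can be checked on sets. *)
Lemma distributive_lattice_of_sets (X : choiceType) (A : finType)
    (f : X -> {set A}) (meet join : X -> X -> X) :
  injective f ->
  (forall x y, f (meet x y) = f x :&: f y) ->
  (forall x y, f (join x y) = f x :|: f y) ->
  is_distributive_lattice (fun x y => f x \subset f y).
Proof.
move=> fI fM fJ; pose r x y := f x \subset f y.
pose lt x y := (y != x) && r x y.
have lt_def x y : lt x y = (y != x) && r x y by [].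
have le_def x y : r x y = (meet x y == x).
  by rewrite -(inj_eq fI) fM; apply/setIidPl/eqP.
have mC : commutative meet by move=> x y; apply: fI; rewrite !fM setIC.
have jC : commutative join by move=> x y; apply: fI; rewrite !fJ setUC.
have mA : associative meet by move=> x y z; apply: fI; rewrite !fM setIA.
have jA : associative join by move=> x y z; apply: fI; rewrite !fJ setUA.
have jK y x : meet x (join x y) = x by apply: fI; rewrite fM fJ setUC setKU.
have mK y x : join x (meet x y) = x by apply: fI; rewrite fJ fM setIC setKI.
have mD : left_distributive meet join.
  by move=> x y z; apply: fI; rewrite !(fM, fJ) setIUl.
have mx : idempotent_op meet by move=> x; apply: fI; rewrite fM setIid.
(* [Build] fails to infer the class of an abstract [X]. *)
pose mix : Order.isMeetJoinDistrLattice.axioms_ (Order.Disp tt tt) X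
    (Choice.class X) (Choice.class X) :=
  Order.isMeetJoinDistrLattice.Axioms_ _ r lt meet join le_def lt_def
    mC jC mA jA jK mK mD mx.
pose L : distrLatticeType (Order.Disp tt tt) := HB.pack (X : Type) (Choice.class X) mix.
by exists (Order.DistrLattice.class L).
Qed.

Theorem theorem3p6 (n : nat) (hn : 1 <= n) (T : tree)
    (hT : labelled_trees n.-1 T) :
  (injective (@IT n T) /\
   [set IT T w | w in [set: 'S_n]] = lower_sets n T) /\
  is_distributive_lattice (@leT n T).
Proof.
case: n hn hT => // m _ hT; have inj := IT_inj hT; split; first split=> //.
  apply/setP => I; apply/imsetP/idP => [[w _ ->]|/(IT_surj hT)[w <-]].
    exact: IT_lower.
  by exists w.
(* [pre] inverts [IT T] on lower sets; the default [1] is never reached there, by surjectivity. *)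
pose pre (I : {set _}) : 'S_m.+1 := odflt 1%g [pick w | IT T w == I].
have preK I : I \in lower_sets m.+1 T -> IT T (pre I) = I.
  case/(IT_surj hT) => w wI; rewrite /pre; case: pickP => [v /eqP //|/(_ w)].
  by rewrite wI eqxx.
apply: (distributive_lattice_of_sets (meet := fun v w => pre (IT T v :&: IT T w))
  (join := fun v w => pre (IT T v :|: IT T w))) => // v w.
- by rewrite preK ?lower_setsI ?IT_lower.
- by rewrite preK ?lower_setsU ?IT_lower.
Qed.
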